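(* Let $\xi$ be an irrational real number and $y$ a real number. There exist infinitely many pairs of coprime integers $(p,q)$ such that $$ |q\xi+p-y|\le \frac{c}{\sqrt{|q|}}\qquad\text{with}\qquad c=2\sqrt{3}\,\max(1,|\xi|)^{1/2}\,|y|^{1/2}. $$
   Formalization: The formal theorem assumes y ≠ 0; for y = 0 the constant c is 0, so the inequality would force qξ + p = 0, impossible for coprime integers p, q when ξ is irrational, and the claim as written fails there. *)

(* Defs.v *)
From mathcomp Require Export all_boot all_order all_algebra.
From mathcomp Require Export mathcomp_extra boolp classical_sets cardinality reals.

(* Main.v *)
Require Import Defs.
From mathcomp Require Import all_boot all_order all_algebra.
From mathcomp Require Import mathcomp_extra boolp classical_sets cardinality reals.
From mathcomp Require Import ring lra zify.

(** Write L(p, q) = q xi + p.  Consecutive convergents of xi give integer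
    vectors (p, q), (P, Q) of determinant d = 1 or -1, with Q as large as desired and
    E = L(P, Q) satisfying 0 < Q |E| <= 1 ([unimodular_approximation]).
    Every vector (U, V) = (p, q) + b (P, Q) still has determinant d or -d with
    (P, Q), so U and V are coprime for each integer b; and as b varies,
    L(U, V) = L(p, q) + b E runs through an arithmetic progression of step E,
    so some b puts it within |E| of y.

    The size of V is then read off from the determinant rather than from b:
    Q L(U, V) - V E is 1 or -1, hence |V| |E| differs from Q |y| by at most
    Q |E| + 1 <= 2.  The upper half of this estimate gives
    |V| |L(U, V) - y|^2 <= |V| |E|^2 <= (Q |y| + 2) |E| <= |y| + 2 |E|, which is
    at most 3 |y| once Q |y| >= 3, and sqrt (3 |y|) <= c.  The lower half gives
    |V| >= Q, since |E| <= 1 / Q; so V is unbounded and infinitely many pairs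
    arise ([coprime_inhomogeneous_approximation]). *)
Import Order.TTheory GRing.Theory Num.Theory.
Local Open Scope classical_set_scope.
Local Open Scope ring_scope.

Definition form {R : realType} (xi : R) (p q : int) : R :=
  q%:~R * xi + p%:~R.

Lemma form_neq0 {R : realType} (xi : R) (p q : int) :
  irrational xi -> q != 0 -> form xi p q != 0.
Proof.
move=> hxi q0; apply/eqP => h; apply: hxi.
exists (- p%:~R / q%:~R) => //.
have qR0 : q%:~R != 0 :> R by rewrite intr_eq0.
rewrite fmorph_div rmorphN /= !ratr_int.
apply: (mulfI qR0); rewrite mulrCA divff // mulr1.
by move: h; rewrite /form; lra.
Qed.

Lemma form_combine {R : realType} (xi : R) (p q P Q a : int) :
  form xi (p + a * P) (q + a * Q) = form xi p q + a%:~R * form xi P Q.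
Proof. by rewrite /form !(rmorphD, rmorphM) /=; ring. Qed.

Lemma form_det {R : realType} (xi : R) (p q P Q : int) :
  q%:~R * form xi P Q - Q%:~R * form xi p q = (q * P - Q * p)%:~R.
Proof. by rewrite /form rmorphB !rmorphM /=; ring. Qed.

(** Division with remainder in R, for a divisor of either sign. *)
Lemma floor_division {R : realType} (x e : R) : e != 0 ->
  exists a : int, exists2 t : R, 0 <= t < 1 & x = (a%:~R + t) * e.
Proof.
move=> e0; exists (Num.floor (x / e)); exists (x / e - (Num.floor (x / e))%:~R).
  by have := floor_itv (x / e); rewrite rmorphD /=; lra.
by rewrite addrC subrK divfK.
Qed.

(** The continued fraction algorithm, run on the vectors (p, q) and (P, Q) of
    two consecutive convergents: the values of the linear form alternate in
    sign and decrease in absolute value.  The determinant d, which changes sign at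
    each step, also records the sign of the last value, so that no parity of
    the index has to be tracked.  It is q + Q, and not Q, that grows at
    each step, because the partial quotient after floor xi may be 1, in which case the
    denominators begin 0, 1, 1. *)
Lemma consecutive_convergents {R : realType} (xi : R) (n : nat) :
  irrational xi ->
  exists p q P Q : int, let d := q * P - Q * p in
  [/\ 0 <= q <= Q, 0 < Q, n%:Z <= q + Q, d * d = 1 &
      0 < d%:~R * form xi P Q < - (d%:~R * form xi p q)].
Proof.
move=> hxi; elim: n => [|n [p [q [P [Q [hq hQ hn hd /andP[f0 fe]]]]]]].
  (* A convergent r / s is represented by the vector (- r, s), which makes the
     form small; these are the formal convergent 1 / 0 and floor xi. *)
  exists (-1), 0, (- Num.floor xi), 1.
  split; rewrite ?mul0r ?sub0r ?mul1r ?opprK ?mulr1 //.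
  have nz := form_neq0 xi (- Num.floor xi) 1 hxi isT.
  have E1 : form xi (- Num.floor xi) 1 = xi - (Num.floor xi)%:~R.
    by rewrite /form rmorphN mul1r.
  have E0 : form xi (-1) 0 = -1 by rewrite /form mul0r add0r rmorphN.
  have /andP[h1 h2] := floor_itv xi.
  rewrite E0 opprK.
  rewrite lt_def nz E1 /=; move: h2; rewrite rmorphD /=; lra.
set d : int := q * P - Q * p in hd f0 fe.
have dR : d%:~R * d%:~R = 1 :> R by rewrite -rmorphM hd.
(* a is the next partial quotient; t, the ratio in absolute value of the
   next two values of the form, is nonzero because xi is irrational. *)
have [a [t /andP[t0 t1] ha]] :=
  floor_division (- (d%:~R * form xi p q)) (d%:~R * form xi P Q) (lt0r_neq0 f0).
have a1 : 1 <= a.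
  rewrite leNgt; apply/negP => a0.
  have aR : a%:~R <= 0 :> R by rewrite lerz0; lia.
  have : (a%:~R + t - 1) * (d%:~R * form xi P Q) <= 0.
    by rewrite nmulr_rle0 ?ltW //; lra.
  by rewrite mulrBl -ha mul1r; lra.
have qaQ : 0 < q + a * Q by nia.
exists P, Q, (p + a * P), (q + a * Q).
have -> : Q * (p + a * P) - (q + a * Q) * P = - d by rewrite /d; ring.
split; [nia|by []|nia|by rewrite mulrNN|].
have nz := form_neq0 xi (p + a * P) (q + a * Q) hxi (lt0r_neq0 qaQ).
rewrite rmorphN !mulNr opprK.
have E : - (d%:~R * form xi (p + a * P) (q + a * Q)) = t * (d%:~R * form xi P Q).
  by rewrite form_combine mulrDr opprD ha; ring.
rewrite E; apply/andP; split; last by nra.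
rewrite lt_def mulr_ge0 ?(ltW f0) // andbT -E oppr_eq0 mulf_neq0 //.
by apply/eqP => d0; move: dR; rewrite d0 mul0r; lra.
Qed.

Lemma normr_unit_int (R : realType) (d : int) : d * d = 1 -> `|d%:~R| = 1 :> R.
Proof.
move=> hd; apply/eqP; rewrite -(@eqrXn2 _ 2) // expr1n -normrX expr2 -rmorphM.
by rewrite hd normr1.
Qed.

(** Expanding the determinant gives q |L(P, Q)| + Q |L(p, q)| = 1, as the two
    values have opposite signs; then Q |L(P, Q)| <= Q |L(p, q)| <= 1. *)
Lemma unimodular_approximation {R : realType} (xi : R) (n : nat) :
  irrational xi ->
  exists p q P Q : int,
  [/\ (q * P - Q * p) * (q * P - Q * p) = 1, n%:Z <= Q &
      0 < Q%:~R * `|form xi P Q| <= 1].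
Proof.
move=> hxi.
have [p [q [P [Q [/andP[q0 qQ] Q0 hn hd /andP[f0 fe]]]]]] :=
  (* q <= Q, so q + Q >= 2 n forces Q >= n. *)
  consecutive_convergents xi (2 * n) hxi.
exists p, q, P, Q; split => //; first by lia.
have := form_det xi p q P Q; move: hd f0 fe.
set d : int := q * P - Q * p => hd f0 fe D.
have dR : d%:~R * d%:~R = 1 :> R by rewrite -rmorphM hd.
have dn : `|d%:~R| = 1 :> R := normr_unit_int R d hd.
have -> : `|form xi P Q| = d%:~R * form xi P Q.
  by rewrite -(gtr0_norm f0) normrM dn mul1r.
have qR : 0 <= q%:~R :> R by rewrite ler0z.
have QR : 0 < Q%:~R :> R by rewrite ltr0z.
rewrite mulr_gt0 //=.
have S : q%:~R * (d%:~R * form xi P Q) + Q%:~R * - (d%:~R * form xi p q) = 1.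
  by apply: (etrans _ dR); rewrite -[X in _ = _ * X]D; ring.
have h1 := ler_pM2l QR (d%:~R * form xi P Q) (- (d%:~R * form xi p q)).
have h2 : 0 <= q%:~R * (d%:~R * form xi P Q) by rewrite mulr_ge0 // ltW.
have : Q%:~R * (d%:~R * form xi P Q) <= Q%:~R * - (d%:~R * form xi p q).
  by rewrite h1 ltW.
lra.
Qed.

Lemma unbounded_infinite (A : set (int * int)) :
  (forall n : nat, exists2 pq, A pq & n%:Z < `|pq.2|) -> infinite_set A.
Proof.
move=> unb /finite_seqP[s As].
have [pq Apq] := unb (\max_(x <- s) `|x.2|)%N.
rewrite -abszE ltz_nat ltnNge => /negP; apply.
by apply: (leq_bigmax_seq (F := fun x : int * int => `|x.2|%N)) => //; move: Apq; rewrite As.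
Qed.

(** A point of the coset (p, q) + Z (P, Q), automatically primitive, chosen so
    that the linear form falls within one step E of y. *)
Lemma coprime_inhomogeneous_approximation {R : realType} (xi y : R) (n : nat) :
  irrational xi -> y != 0 ->
  exists U V : int, [/\ coprimez U V, n%:Z < `|V| &
    `|V|%:~R * `|form xi U V - y| ^+ 2 <= 3 * `|y|].
Proof.
move=> hxi hy.
have y0 : 0 < `|y| by rewrite normr_gt0.
have [N hN1 hN2] : exists2 N : nat, (n < N)%N & 3 <= `|y| * N%:R.
  exists (maxn n.+1 (Num.bound (3 / `|y|))); first by rewrite leq_max leqnn.
  have := archi_boundP (divr_ge0 (ler0n R 3) (ltW y0)).
  rewrite ltr_pdivrMr // mulrC => /ltW h; apply: le_trans h _.
  by rewrite ler_pM2l // ler_nat leq_max leqnn orbT.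
have [p [q [P [Q [hd NQ /andP[QE0 QE1]]]]]] := unimodular_approximation xi N hxi.
set E := form xi P Q in QE0 QE1.
have nQ : n%:Z < Q by apply: lt_le_trans NQ; rewrite ltz_nat.
have Q0 : 0 < Q by apply: le_lt_trans nQ.
have QR : 0 < Q%:~R :> R by rewrite ltr0z.
have E0 : 0 < `|E| by rewrite -(pmulr_rgt0 _ QR).
have yQ : 3 <= `|y| * Q%:~R.
  apply: le_trans hN2 _; rewrite ler_pM2l //.
  by rewrite -[N%:R]/(N%:Z%:~R) ler_int.
have Ey : `|E| <= `|y|.
  by rewrite -(ler_pM2l QR); lra.
have Enz : E != 0 by rewrite -normr_gt0.
have [b [t /andP[t0 t1] hb]] := floor_division (y - form xi p q) E Enz.
exists (p + b * P), (q + b * Q).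
set U := p + b * P; set V := q + b * Q.
have Wy : form xi U V - y = - (t * E).
  have -> : y = form xi p q + (y - form xi p q) by rewrite addrC subrK.
  by rewrite form_combine hb -/E; ring.
have det : Q * U - V * P = - (q * P - Q * p) by rewrite /U /V; ring.
set d := q * P - Q * p in hd det.
have dn : `|d%:~R| = 1 :> R := normr_unit_int R d hd.
(* The determinant of (P, Q) and (U, V), solved for V. *)
have VE : `|V|%:~R * `|E| = `|Q%:~R * (y - t * E) + d%:~R|.
  rewrite intr_norm -normrM; congr (`| _ |).
  have := form_det xi P Q U V; rewrite det rmorphN -/E => D.
  have -> : y - t * E = form xi U V by rewrite -Wy addrC subrK.
  by apply/eqP; rewrite -subr_eq0 -oppr_eq0 opprB addrAC D addNr.
have tE : `|t * E| <= `|E| by rewrite normrM ger0_norm // ler_piMl // ltW.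
have up : `|V|%:~R * `|E| <= Q%:~R * `|y| + 2.
  rewrite VE; apply: le_trans (ler_normD _ _) _; rewrite dn normrM gtr0_norm //.
  have := ler_wpM2l (ltW QR) (le_trans (ler_normB y (t * E)) (lerD (lexx _) tE)).
  lra.
have lo : Q%:~R * `|y| - 2 <= `|V|%:~R * `|E|.
  rewrite VE; have := lerB_normD (Q%:~R * (y - t * E)) d%:~R.
  rewrite dn normrM (gtr0_norm QR).
  have := ler_wpM2l (ltW QR) (le_trans (lerB (lexx _) tE) (lerB_dist y (t * E))).
  lra.
split.
- apply/coprimezP; exists (- d * Q, d * P) => /=.
  have -> : - d * Q * U + d * P * V = - d * (Q * U - V * P) by ring.
  by rewrite det mulrNN.
- have QV : Q%:~R <= `|V|%:~R :> R.
    rewrite -(ler_pM2r E0); lra.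
  by apply: lt_le_trans nQ _; rewrite ler_int in QV.
- rewrite Wy normrN.
  have h1 : `|t * E| ^+ 2 <= `|E| ^+ 2 by rewrite lerXn2r ?nnegrE.
  have V0 : 0 <= `|V|%:~R :> R by rewrite ler0z.
  have h2 := ler_wpM2l V0 h1.
  apply: (le_trans h2); rewrite expr2 mulrA.
  apply: (le_trans (ler_wpM2r (ltW E0) up)).
  have h4 := ler_wpM2r (ltW y0) QE1.
  lra.
Qed.

Theorem theorem1 (R : realType) (xi y : R) (hxi : irrational xi) (hy : y != 0) :
  let c : R := 2 * Num.sqrt 3 * Num.sqrt (Num.max 1 `|xi|) * Num.sqrt `|y| in
  infinite_set [set pq : int * int |
    [/\ coprimez pq.1 pq.2,
        pq.2 != 0 &
        `|pq.2%:~R * xi + pq.1%:~R - y| <= c / Num.sqrt `|pq.2%:~R|]].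
Proof.
move=> c; apply: unbounded_infinite => n.
have [U [V [coUV nV bound]]] :=
  coprime_inhomogeneous_approximation xi y n hxi hy.
have V0 : V != 0 by apply/eqP => V0; rewrite V0 in nV.
exists (U, V) => //=; split=> //; rewrite -/(form xi U V).
have VR : 0 < `|V%:~R| :> R by rewrite normr_gt0 intr_eq0.
rewrite ler_pdivlMr ?sqrtr_gt0 //.
have sq3y : `|form xi U V - y| * Num.sqrt `|V%:~R| <= Num.sqrt (3 * `|y|).
  rewrite -[X in X * _]normr_id -sqrtr_sqr -sqrtrM ?sqr_ge0 //.
  by rewrite ler_wsqrtr // mulrC -intr_norm.
apply: le_trans sq3y _; rewrite sqrtrM // /c.
apply: ler_wpM2r; first exact: sqrtr_ge0.
have m1 : 1 <= Num.sqrt (Num.max 1 `|xi|) :> R.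
  by rewrite -[leLHS]sqrtr1 ler_wsqrtr // le_max lexx.
have s3 := sqrtr_ge0 (3 : R).
have h := ler_wpM2l s3 m1.
lra.
Qed.
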